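(* Let $\Omega\subset\mathbb{R}^m$ be a closed set that is $\mathcal{C}^2$-cone reducible at $\bar y\in\Omega$ to a closed convex cone $\Xi\subset\mathbb{R}^s$ via a mapping $h$, i.e. there exist a neighborhood $\mathcal{U}\subset\mathbb{R}^m$ of $\bar y$ and a $\mathcal{C}^2$-smooth mapping $h:\mathbb{R}^m\to\mathbb{R}^s$ such that $$\Omega\cap\mathcal{U}=\{y\in\mathcal{U}:h(y)\in\Xi\},\quad h(\bar y)=0,\quad \nabla h(\bar y)\text{ has full rank }s.$$ Let $\lambda\in N_\Omega(\bar y)$. Then $\Omega$ is parabolically derivable at $\bar y$ for any vector $w\in T_\Omega(\bar y)$ and parabolically regular at $\bar y$ for $\lambda$. Consequently, its indicator function $\delta_\Omega$ is properly twice epi-differentiable at $\bar y$ for $\lambda$, with the second subderivative $$\mathrm{d}^2\delta_\Omega(\bar y,\lambda)(w)=\begin{cases}\langle\mu,\nabla^2h(\bar y)(w,w)\rangle&\text{if }w\in K_\Omega(\bar y,\lambda),\\ \infty&\text{otherwise,}\end{cases}$$ where $\mu\in\mathbb{R}^s$ is the unique solution to the system $\lambda=\nabla h(\bar y)^*\mu$, $\mu\in N_\Xi(h(\bar y))$.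
   Context: $\delta_\Omega$ is the indicator function of $\Omega$; $\nabla^2h(\bar y)(w,v)=(\langle\nabla^2h_1(\bar y)w,v\rangle,\dots,\langle\nabla^2h_s(\bar y)w,v\rangle)$. Tangent cone: $T_\Omega(\bar x)=\{w:\exists t_k\downarrow0,\ w_k\to w,\ \bar x+t_kw_k\in\Omega\}$. Regular normal cone: $\widehat N_\Omega(\bar x)=\{v:\limsup_{x\to\bar x,\,x\in\Omega,\,x\neq\bar x}\frac{\langle v,x-\bar x\rangle}{\|x-\bar x\|}\le0\}$. Limiting normal cone: $N_\Omega(\bar x)=\{v:\exists x_k\to\bar x,\ x_k\in\Omega,\ v_k\to v,\ v_k\in\widehat N_\Omega(x_k)\}$ (for convex sets this is the normal cone of convex analysis). Critical cone for $\bar v\in N_\Omega(\bar x)$: $K_\Omega(\bar x,\bar v)=T_\Omega(\bar x)\cap\{\bar v\}^\perp$. Second-order tangent set: $T^2_\Omega(\bar x,w)=\{u:\exists t_k\downarrow0,\ u_k\to u,\ \bar x+t_kw+\tfrac12t_k^2u_k\in\Omega\}$. $\Omega$ is parabolically derivable at $\bar x$ for $w$ if $T^2_\Omega(\bar x,w)\ne\emptyset$ and for each $u\in T^2_\Omega(\bar x,w)$ there are $\varepsilon>0$ and an arc $\xi:[0,\varepsilon]\to\Omega$ with $\xi(0)=\bar x$, $\xi'_+(0)=w$ and $\xi''_+(0):=\lim_{t\downarrow0}\frac{\xi(t)-\xi(0)-t\xi'_+(0)}{\frac12t^2}=u$. Second-order difference quotients: $\Delta_t^2\varphi(\bar x,\bar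 v)(u)=\frac{\varphi(\bar x+tu)-\varphi(\bar x)-t\langle\bar v,u\rangle}{\frac12t^2}$, $t>0$. Second subderivative: $\mathrm{d}^2\varphi(\bar x,\bar v)(w)=\liminf_{t\downarrow0,\,u\to w}\Delta_t^2\varphi(\bar x,\bar v)(u)$. $\varphi$ is twice epi-differentiable at $\bar x$ for $\bar v$ if the sets $\operatorname{epi}\Delta_t^2\varphi(\bar x,\bar v)$ converge (Painlevé–Kuratowski) to $\operatorname{epi}\mathrm{d}^2\varphi(\bar x,\bar v)$ as $t\downarrow0$; equivalently, for every $w$ and every $t_k\downarrow0$ there is $w_k\to w$ with $\Delta_{t_k}^2\varphi(\bar x,\bar v)(w_k)\to\mathrm{d}^2\varphi(\bar x,\bar v)(w)$. It is properly so if in addition $\mathrm{d}^2\varphi(\bar x,\bar v)$ is proper (never $-\infty$, not identically $\infty$). $\Omega$ is parabolically regular at $\bar x\in\Omega$ for $\bar v$ if for every $w$ with $\mathrm{d}^2\delta_\Omega(\bar x,\bar v)(w)<\infty$ there exist sequences $t_k\downarrow0$, $w_k\to w$ with $\Delta^2_{t_k}\delta_\Omega(\bar x,\bar v)(w_k)\to\mathrm{d}^2\delta_\Omega(\bar x,\bar v)(w)$ and $\limsup_{k\to\infty}\|w_k-w\|/t_k<\infty$. *)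

(* Defs.v *)
From HB Require Import structures.
From mathcomp Require Import all_boot all_order all_algebra.
From mathcomp Require Import all_classical all_reals all_analysis.

Set Implicit Arguments.
Unset Strict Implicit.
Unset Printing Implicit Defensive.
Import Order.TTheory GRing.Theory Num.Theory.
Import numFieldNormedType.Exports.

Local Open Scope classical_set_scope.
Local Open Scope ring_scope.

(* R^n is 'rV[R]_n.  Its library norm is the sup norm, which induces the usual
   topology; [enorm] is the Euclidean norm. *)

Section Euclidean.
Context {R : realType} {n : nat}.
Implicit Types u v : 'rV[R]_n.

Definition dotp u v : R := \sum_i u 0 i * v 0 i.

Definition enorm u : R := Num.sqrt (dotp u u).

End Euclidean.

Section SecondOrderDerivatives.
Context {R : realType} {m : nat}.
Implicit Types f : 'rV[R]_m -> R.

Definition grad f (x : 'rV[R]_m) : 'rV[R]_m :=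
  \row_i 'D_(delta_mx 0 i) f x.

(* The (i, j) entry is the i-th partial derivative of the j-th partial
   derivative of f, because 'J acts on row vectors from the right. *)
Definition hess f (x : 'rV[R]_m) : 'M[R]_m := 'J (grad f) x.

Definition C2_fun f : Prop :=
  [/\ forall x, differentiable f x,
      forall x, differentiable (grad f) x
    & continuous (hess f)].

Definition C2_map s (h : 'rV[R]_m -> 'rV[R]_s) : Prop :=
  forall j, C2_fun (fun x => h x 0 j).

(* nabla^2 h (x) (w, v) *)
Definition hess_map s (h : 'rV[R]_m -> 'rV[R]_s) (x w v : 'rV[R]_m) :
    'rV[R]_s :=
  \row_j dotp (w *m hess (fun y => h y 0 j) x) v.

End SecondOrderDerivatives.

(* t_k \downarrow 0: positive and convergent to 0, not necessarily monotone. *)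
Definition down_to0 {R : realType} (t : nat -> R) : Prop :=
  (forall k, 0 < t k) /\ t @ \oo --> 0.

Section VariationalGeometry.
Context {R : realType} {n : nat}.
Implicit Types (Omega : set 'rV[R]_n) (x v w u : 'rV[R]_n).

Definition tangent_cone Omega x : set 'rV[R]_n :=
  [set w | exists (t : nat -> R) (w_ : nat -> 'rV[R]_n),
    [/\ down_to0 t, w_ @ \oo --> w & forall k, Omega (x + t k *: w_ k)]].

Definition regular_normal_cone Omega x : set 'rV[R]_n :=
  [set v | (limf_esup (fun y : 'rV[R]_n => (dotp v (y - x) / enorm (y - x))%:E)
                      (within Omega x^') <= 0)%E].

Definition normal_cone Omega x : set 'rV[R]_n :=
  [set v | exists x_ v_ : nat -> 'rV[R]_n,
    [/\ x_ @ \oo --> x, forall k, Omega (x_ k), v_ @ \oo --> v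
      & forall k, regular_normal_cone Omega (x_ k) (v_ k)]].

Definition critical_cone Omega x v : set 'rV[R]_n :=
  tangent_cone Omega x `&` [set w | dotp v w = 0].

Definition second_order_tangent_set Omega x w : set 'rV[R]_n :=
  [set u | exists (t : nat -> R) (u_ : nat -> 'rV[R]_n),
    [/\ down_to0 t, u_ @ \oo --> u
      & forall k, Omega (x + t k *: w + (2^-1 * t k ^+ 2) *: u_ k)]].

Definition parabolically_derivable Omega x w : Prop :=
  second_order_tangent_set Omega x w !=set0 /\
  forall u, second_order_tangent_set Omega x w u ->
    exists (e : R) (xi : R -> 'rV[R]_n),
      [/\ 0 < e, forall t, 0 <= t <= e -> Omega (xi t), xi 0 = x,
          t^-1 *: (xi t - xi 0) @[t --> 0^'+] --> w
        & (2^-1 * t ^+ 2)^-1 *: (xi t - xi 0 - t *: w) @[t --> 0^'+] --> u].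

Definition closed_convex_cone Omega : Prop :=
  [/\ closed Omega, @convex_set R 'rV[R]_n Omega, Omega 0
    & forall (a : R) x, 0 < a -> Omega x -> Omega (a *: x)].

End VariationalGeometry.

Section SetConvergence.
Context {R : realType} {E : topologicalType}.
Implicit Types (C : R -> set E) (D : set E).

(* Outer and inner limits as t \downarrow 0. *)
Definition outer_limit C : set E :=
  [set z | exists (t : nat -> R) (z_ : nat -> E),
    [/\ down_to0 t, z_ @ \oo --> z & forall k, C (t k) (z_ k)]].

Definition inner_limit C : set E :=
  [set z | forall t : nat -> R, down_to0 t ->
    exists z_ : nat -> E,
      z_ @ \oo --> z /\ \forall k \near \oo, C (t k) (z_ k)].

Definition PK_converges C D : Prop :=
  outer_limit C = D /\ inner_limit C = D.

End SetConvergence.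

Section SecondSubderivative.
Context {R : realType} {n : nat}.
Implicit Types (phi : 'rV[R]_n -> \bar R) (Omega : set 'rV[R]_n).
Implicit Types (x v w u : 'rV[R]_n).

Definition indicator_fun Omega x : \bar R :=
  if `[< Omega x >] then 0%E else +oo%E.

(* Meant for phi finite at x. *)
Definition diff_quotient2 phi x v (t : R) u : \bar R :=
  ((phi (x + t *: u)%R - phi x - (t * dotp v u)%:E)
     * ((2^-1 * t ^+ 2)^-1)%:E)%E.

Definition second_subderivative phi x v w : \bar R :=
  limf_einf (fun p : R * 'rV[R]_n => diff_quotient2 phi x v p.1 p.2)
            (filter_prod (0 : R)^'+ (nbhs w)).

Definition epigraph phi : set ('rV[R]_n * R) :=
  [set p | (phi p.1 <= (p.2)%:E)%E].

Definition proper_fun phi : Prop :=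
  (forall w, phi w <> -oo%E) /\ (exists w, phi w <> +oo%E).

Definition twice_epi_differentiable phi x v : Prop :=
  PK_converges (fun t : R => epigraph (diff_quotient2 phi x v t))
               (epigraph (second_subderivative phi x v)).

Definition properly_twice_epi_differentiable phi x v : Prop :=
  twice_epi_differentiable phi x v /\ proper_fun (second_subderivative phi x v).

Definition parabolically_regular Omega x v : Prop :=
  let delta := indicator_fun Omega in
  forall w, (second_subderivative delta x v w < +oo)%E ->
    exists (t : nat -> R) (w_ : nat -> 'rV[R]_n),
      [/\ down_to0 t, w_ @ \oo --> w,
          diff_quotient2 delta x v (t k) (w_ k) @[k --> \oo]
            --> second_subderivative delta x v w
        & (limn_esup (fun k => (enorm (w_ k - w) / t k)%:E) < +oo)%E].

End SecondSubderivative.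

Definition C2_cone_reducible {R : realType} {m s : nat} (Omega : set 'rV[R]_m)
    (y : 'rV[R]_m) (Xi : set 'rV[R]_s) (h : 'rV[R]_m -> 'rV[R]_s) : Prop :=
  [/\ closed_convex_cone Xi, C2_map h,
      exists2 U, nbhs y U & Omega `&` U = [set z | U z /\ Xi (h z)],
      h y = 0 & \rank ('J h y) = s].

(* Main.v *)
Require Import Defs.
From HB Require Import structures.
From mathcomp Require Import all_boot all_order all_algebra.
From mathcomp Require Import all_classical all_reals all_analysis.
From mathcomp Require Import ring lra.

(* Write J for the Jacobian of h at ybar.  Since J has full rank, the
   Lyusternik theorem corrects any x near ybar to a point of Omega within
   O(|h x - z|), for any prescribed z near 0 in Xi.  With the Taylor remainder
   B t u := (h (ybar + t u) - t u J) / (t^2/2), which tends to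
   nabla^2 h(w, w) as t -> 0+ and u -> w, membership of ybar + t u in Omega
   reads u J + (t/2) B t u \in Xi.  Hence T_Omega = {w | w J \in Xi}, and
   corrected parabolas ybar + t w + (t^2/2) u_t stay in Omega as soon as
   u J + nabla^2 h(w, w) is a limit of b with w J + (t/2) b \in Xi.
   The multiplier mu = P^* lambda, for P a right inverse of J, is polar to Xi.
   Pairing mu with u J + (t/2) B t u \in Xi bounds the quotient
   -(2/t) <lambda, u> from below by <mu, B t u>, and the bound is attained in
   the limit along the parabola with u J = - nabla^2 h(w, w). *)

Set Implicit Arguments.
Unset Strict Implicit.
Unset Printing Implicit Defensive.
Import Order.TTheory GRing.Theory Num.Theory.
Import numFieldNormedType.Exports.

Local Open Scope classical_set_scope.
Local Open Scope ring_scope.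

(** * Sup-norm, Euclidean-norm and pairing estimates for row vectors *)

Section RowVectors.
Context {R : realType}.

Lemma norm_mx_le m n (A : 'M[R]_(m, n)) (e : R) :
  0 <= e -> (forall i j, `|A i j| <= e) -> `|A| <= e.
Proof.
move=> e0 Ae; rewrite [leLHS]/Num.norm /= mx_normrE.
by apply/bigmax_leP; split => //= -[i j] _; exact: Ae.
Qed.

Lemma le_coord_norm m n (A : 'M[R]_(m, n)) i j : `|A i j| <= `|A|.
Proof.
rewrite [leRHS]/Num.norm /= mx_normrE.
exact: (@le_bigmax _ _ _ _ (fun ij => `|A ij.1 ij.2|) (i, j)).
Qed.

Lemma norm_mulmx_le m n p (A : 'M[R]_(n, p)) :
  exists2 C : R, 0 < C & forall v : 'M[R]_(m, n), `|v *m A| <= C * `|v|.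
Proof.
(* The [+ 1] keeps the constant positive when [A = 0], so that later estimates may divide by it. *)
exists (n%:R * `|A| + 1) => [|v]; first by rewrite ltr_wpDl ?mulr_ge0.
apply: norm_mx_le => [|i j]; first by rewrite mulr_ge0 ?addr_ge0 ?mulr_ge0.
rewrite mxE (le_trans (ler_norm_sum _ _ _))//.
apply: (@le_trans _ _ (\sum_(k < n) `|v| * `|A|)).
  by apply: ler_sum => k _; rewrite normrM ler_pM ?le_coord_norm.
rewrite sumr_const card_ord mulrDl mul1r -[in leLHS]mulr_natl mulrA -[leLHS]addr0.
by rewrite lerD// mulrAC.
Qed.

Lemma cvg_mulmx T (F : set_system T) {FF : Filter F} m n p
    (f : T -> 'M[R]_(m, n)) (l : 'M[R]_(m, n)) (A : 'M[R]_(n, p)) :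
  f @ F --> l -> f x *m A @[x --> F] --> l *m A.
Proof.
have [C C0 AC] := norm_mulmx_le m A.
move=> /cvgrPdist_le fl; apply/cvgrPdist_le => e e0.
near=> x; rewrite -mulmxBl (le_trans (AC _))// -ler_pdivlMl// mulrC.
by near: x; apply: fl; rewrite divr_gt0.
Unshelve. all: end_near. Qed.

Lemma dotpE n (u v : 'rV[R]_n) : dotp u v = (u *m v^T) 0 0.
Proof. by rewrite mxE; apply: eq_bigr => i _; rewrite mxE. Qed.

Lemma dotpC n (u v : 'rV[R]_n) : dotp u v = dotp v u.
Proof. by apply: eq_bigr => i _; rewrite mulrC. Qed.

Lemma dotpDr n (u v w : 'rV[R]_n) : dotp u (v + w) = dotp u v + dotp u w.
Proof. by rewrite !dotpE linearD mulmxDr mxE. Qed.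

Lemma dotpZr n (a : R) (u v : 'rV[R]_n) : dotp u (a *: v) = a * dotp u v.
Proof. by rewrite !dotpE linearZ -scalemxAr mxE. Qed.

Lemma dotpNr n (u v : 'rV[R]_n) : dotp u (- v) = - dotp u v.
Proof. by rewrite -scaleN1r dotpZr mulN1r. Qed.

Lemma dotpBr n (u v w : 'rV[R]_n) : dotp u (v - w) = dotp u v - dotp u w.
Proof. by rewrite dotpDr dotpNr. Qed.

Lemma dotp0r n (u : 'rV[R]_n) : dotp u 0 = 0.
Proof. by rewrite -(scale0r 0) dotpZr mul0r. Qed.

Lemma dotpBl n (u v w : 'rV[R]_n) : dotp (u - v) w = dotp u w - dotp v w.
Proof. by rewrite !(dotpC _ w) dotpBr. Qed.

Lemma dotp_mulmxr n p (u : 'rV[R]_n) (v : 'rV[R]_p) (A : 'M[R]_(p, n)) :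
  dotp u (v *m A) = dotp (u *m A^T) v.
Proof. by rewrite !dotpE trmx_mul mulmxA. Qed.

Lemma dotp_delta n (u : 'rV[R]_n) i : dotp u (delta_mx 0 i) = u 0 i.
Proof. by rewrite dotpE trmx_delta -colE mxE. Qed.

Lemma dotp_inj n (u v : 'rV[R]_n) : (forall w, dotp u w = dotp v w) -> u = v.
Proof. by move=> uv; apply/rowP => i; rewrite -!dotp_delta. Qed.

Lemma norm_dotp_le n (u v : 'rV[R]_n) : `|dotp u v| <= n%:R * `|u| * `|v|.
Proof.
rewrite (le_trans (ler_norm_sum _ _ _))//.
apply: (@le_trans _ _ (\sum_(k < n) `|u| * `|v|)).
  by apply: ler_sum => k _; rewrite normrM ler_pM ?le_coord_norm.
by rewrite sumr_const card_ord -[in leLHS]mulr_natl mulrA.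
Qed.

Lemma cvg_coord T (F : set_system T) {FF : Filter F} m n
    (f : T -> 'M[R]_(m, n)) (l : 'M[R]_(m, n)) i j :
  f @ F --> l -> f x i j @[x --> F] --> l i j.
Proof.
move=> /cvgrPdist_le fl; apply/cvgrPdist_le => e /fl.
apply: filterS => x; apply: le_trans.
by have := le_coord_norm (l - f x) i j; rewrite !mxE.
Qed.

Lemma cvg_dotp T (F : set_system T) {FF : Filter F} n (f g : T -> 'rV[R]_n)
    (a b : 'rV[R]_n) :
  f @ F --> a -> g @ F --> b -> dotp (f x) (g x) @[x --> F] --> dotp a b.
Proof.
move=> fa gb; rewrite /dotp.
apply: cvg_big => [|i _]; first exact: add_continuous.
by apply: cvgM; exact: cvg_coord.
Qed.

Lemma enorm_ge0 n (u : 'rV[R]_n) : 0 <= enorm u.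
Proof. exact: sqrtr_ge0. Qed.

(** The squared norm is at most [n] times the squared sup norm; weakening [n] to its square avoids a
    root in the constant. *)
Lemma enorm_le n (u : 'rV[R]_n) : enorm u <= n%:R * `|u|.
Proof.
rewrite -[leRHS]ger0_norm ?mulr_ge0// -sqrtr_sqr ler_wsqrtr//.
apply: le_trans (ler_norm _) _; apply: le_trans (norm_dotp_le _ _) _.
rewrite exprMn !expr2 -mulrA ler_wpM2r ?mulr_ge0//.
by case: n u => [u|n u]; [rewrite mulr0|rewrite ler_peMl// ler1n].
Qed.

Lemma norm_le_enorm n (u : 'rV[R]_n) : `|u| <= enorm u.
Proof.
apply: norm_mx_le => [|i j]; first exact: enorm_ge0.
rewrite ord1 -sqrtr_sqr ler_wsqrtr// /dotp (bigD1 j)//= -expr2 lerDl.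
by apply: sumr_ge0 => k _; rewrite -expr2 sqr_ge0.
Qed.

End RowVectors.

(** * Gradients and derivatives along lines *)

Section Calculus.
Context {R : realType} {m : nat}.
Implicit Types (f : 'rV[R]_m -> R) (x d : 'rV[R]_m).

Lemma dotp_grad f x d : differentiable f x -> dotp (grad f x) d = 'd f x d.
Proof.
move=> df; rewrite [in RHS](row_sum_delta d) linear_sum; apply: eq_bigr => i _.
by rewrite linearZ mxE deriveE// mulrC.
Qed.

Lemma is_derive_line f x d (t : R) : (forall z, differentiable f z) ->
  is_derive t 1 (fun r : R => f (x + r *: d)) (dotp (grad f (x + t *: d)) d).
Proof.
move=> df.
have dl : is_diff t (fun r : R => x + r *: d) (fun r : R => r *: d).
  (* For a constant plus a linear map, [is_diffD] produces the differential in the form zero plus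
     linear. *)
  have -> : (fun r : R => r *: d) = 0 + (fun r : R => r *: d) :> (R -> 'rV[R]_m).
    by rewrite add0r.
  apply: is_diffD.
have dfl : differentiable (fun r : R => f (x + r *: d)) t.
  exact: (@differentiable_comp _ _ _ _ (fun r : R => x + r *: d) f).
apply: DeriveDef; first exact/diff_derivable.
rewrite deriveE// (diff_comp (f := fun r : R => x + r *: d) (g := f))//=.
by rewrite diff_val scale1r dotp_grad.
Qed.

End Calculus.

(** * Strict differentiability and second-order Taylor bound for real-valued functions *)

Section ScalarTaylor.
Context {R : realType} {m : nat} (f : 'rV[R]_m -> R).
Context (df : forall z, differentiable f z).

(** The mean value theorem on the segment from [x] to [x'] yields the gradient at an intermediate
    point, which lies in the same ball around [y] by convexity and is therefore close to
    [grad f y]. *)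
Lemma strictly_differentiable (y : 'rV[R]_m) (e : R) :
  {for y, continuous (grad f)} -> 0 < e ->
  \forall r \near 0^'+, forall x x' : 'rV[R]_m, `|y - x| <= r -> `|y - x'| <= r ->
    `|f x' - f x - dotp (grad f y) (x' - x)| <= e * `|x' - x|.
Proof.
(* [k] exceeds the factor [m] of [norm_dotp_le] and is nonzero even if [m = 0]. *)
move=> cf e0; pose k : R := m%:R + 1.
have k0 : 0 < k by rewrite ltr_wpDl.
have /cvgrPdist_le/(_ (e / k)) := cf.
rewrite divr_gt0// => /(_ erefl)/nbhs_normP[r r0 rP].
near=> t => x x' xt x't.
have [||c c01] := @MVT_segment R (fun r => f (x + r *: (x' - x)))
  (fun r => dotp (grad f (x + r *: (x' - x))) (x' - x)) 0 1 ler01.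
- by move=> z _; exact: is_derive_line.
- apply: derivable_within_continuous => z _.
  by have [] := is_derive_line x (x' - x) z df.
rewrite scale1r scale0r addr0 subrKC subr0 mulr1 => ->.
rewrite -dotpBl (le_trans (norm_dotp_le _ _))// ler_wpM2r//.
rewrite (@le_trans _ _ (k * (e / k)))//; last by rewrite mulrCA divff ?mulr1// gt_eqF.
apply: ler_pM => //; first by rewrite lerDl.
rewrite distrC; apply: rP => /=.
move: c01; rewrite in_itv/= => /andP[c0 c1].
have -> : y - (x + c *: (x' - x)) = (1 - c) *: (y - x) + c *: (y - x').
  by apply/rowP => i; rewrite !mxE; ring.
apply: (@le_lt_trans _ _ t); last by near: t; exact: nbhs_right_lt.
rewrite (le_trans (ler_normD _ _))// !normrZ (ger0_norm c0) ger0_norm ?subr_ge0//.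
rewrite -[leRHS]mul1r -[X in X * t](subrK c) [leRHS]mulrDl.
by rewrite lerD// ler_wpM2l// subr_ge0.
Unshelve. all: end_near. Qed.

(** The mean value theorem is applied to [f] minus its linear and quadratic Taylor terms along the
    segment. The derivative there is the first-order remainder of [grad f] at [y] paired with [d]:
    each contributes one factor of the norm of [d]. *)
Lemma taylor2 (y : 'rV[R]_m) (e : R) :
  differentiable (grad f) y -> 0 < e ->
  \forall r \near 0^'+, forall d : 'rV[R]_m, `|d| <= r ->
    `|f (y + d) - f y - dotp (grad f y) d - 2^-1 * dotp (d *m hess f y) d|
      <= e * `|d| ^+ 2.
Proof.
move=> dg e0; pose k : R := m%:R + 1.
have k0 : 0 < k by rewrite ltr_wpDl.
have /eqaddoP/(_ _ (divr_gt0 e0 k0))/nbhs_normP[r r0 rP] := diff_locally dg.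
near=> t => d dt.
pose q (c : R) := f (y + c *: d) - c * dotp (grad f y) d -
  2^-1 * c ^+ 2 * dotp (d *m hess f y) d.
pose q' (c : R) := dotp (grad f (y + c *: d)) d - dotp (grad f y) d -
  c * dotp (d *m hess f y) d.
have dq c : is_derive c (1 : R) q (q' c).
  have := is_derive_line y d c df => ?.
  rewrite /q; apply: is_derive_eq; rewrite /q'.
  move: (dotp (grad f (y + c *: d)) d) (dotp (grad f y) d) (dotp (_ *m _) d).
  by move=> a b b'; rewrite /GRing.scale /=; field.
have [|c c01] := @MVT_segment R q q' 0 1 ler01.
  by apply: derivable_within_continuous => z _; have [] := dq z.
rewrite /q scale1r scale0r addr0 !mul0r expr0n/= mulr0 mul0r !subr0 mulr1 mul1r.
rewrite expr1n mulr1 => qE.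
rewrite [X in `|X|](_ : _ = q' c); last by rewrite -qE; ring.
move: c01; rewrite in_itv/= => /andP[c0 c1].
have cd : `|c *: d| <= `|d| by rewrite normrZ ger0_norm// ler_piMl.
rewrite /q' [c * _](_ : _ = dotp (c *: d *m hess f y) d); last first.
  by rewrite -scalemxAl !(dotpC _ d) dotpZr.
rewrite -!dotpBl (le_trans (norm_dotp_le _ _))// expr2 mulrA ler_wpM2r//.
have /rP : `|0 - c *: d| < r.
  rewrite sub0r normrN (le_lt_trans cd)// (le_lt_trans dt)//.
rewrite /= /hess mul_rV_lin1 opprD addrA [y + _]addrC => /le_trans le1.
rewrite -[leRHS]mul1r.
have -> : e * `|d| = k * (e / k * `|d|) by rewrite mulrA mulrCA divff ?mulr1// gt_eqF.
rewrite mul1r ler_pM// ?lerDl//; apply: le1.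
by rewrite ler_wpM2l// divr_ge0// ltW.
Unshelve. all: end_near. Qed.
End ScalarTaylor.

(** Completeness of the row space is what the Banach fixed point theorem in [lyusternik] rests
    on. *)
HB.instance Definition _ (R : realType) n :=
  Uniform_isComplete.Build 'rV[R]_n cauchy_cvg.

Lemma differentiable_linear_approx (R : realType) (V W : normedModType R)
    (f : V -> W) (x : V) (L : {linear V -> W}) :
  continuous L ->
  (forall e : R, 0 < e -> exists2 r : R, 0 < r &
    forall d, `|d| < r -> `|f (x + d) - f x - L d| <= e * `|d|) ->
  differentiable f x /\ 'd f x = L :> (V -> W).
Proof.
move=> cL fL.
have dL : f \o shift x = cst (f x) + L +o_ 0 id.
  apply/eqaddoP => e /fL[r r0 rP].
  apply/nbhs_normP; exists r => //= d; rewrite /= sub0r normrN => /rP.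
  by rewrite -[(_ - _) d]/(f (d + x) - (f x + L d)) opprD addrA [d + x]addrC.
have dfE := diff_unique cL dL; split=> //.
by apply/diff_locallyP; rewrite dfE.
Qed.

(** * Vector-valued C2 maps, treated coordinate by coordinate *)

Section VectorMaps.
Context {R : realType} {m s : nat} (h : 'rV[R]_m -> 'rV[R]_s).
Context (C2h : C2_map h).

(** The candidate Jacobian; it is identified with ['J h y] only once [h] is known to be
    differentiable. *)
Let gradmx (y : 'rV[R]_m) : 'M[R]_(m, s) :=
  \matrix_(i, j) grad (fun x => h x 0 j) y 0 i.

Let mul_gradmx (y d : 'rV[R]_m) j :
  (d *m gradmx y) 0 j = dotp (grad (fun x => h x 0 j) y) d.
Proof. by rewrite dotpC mxE; apply: eq_bigr => i _; rewrite !mxE. Qed.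

Let strictly_differentiable_gradmx (y : 'rV[R]_m) (e : R) : 0 < e ->
  \forall r \near 0^'+, forall x x' : 'rV[R]_m, `|y - x| <= r -> `|y - x'| <= r ->
    `|h x' - h x - (x' - x) *m gradmx y| <= e * `|x' - x|.
Proof.
move=> e0.
suff : \forall r \near (0 : R)^'+, forall j, forall x x' : 'rV[R]_m, `|y - x| <= r ->
    `|y - x'| <= r -> `|h x' 0 j - h x 0 j -
      dotp (grad (fun x => h x 0 j) y) (x' - x)| <= e * `|x' - x|.
  apply: filterS => r hr x x' yx yx'.
  apply: norm_mx_le => [|i j]; first by rewrite mulr_ge0// ltW.
  by rewrite ord1; move: (hr j x x' yx yx'); rewrite -mul_gradmx !mxE.
(* There are finitely many coordinates, so one radius serves them all. *)
apply: filter_forall => j; have [df dg _] := C2h j.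
exact: (strictly_differentiable df (differentiable_continuous (dg y)) e0).
Qed.

Lemma diff_C2_map (y : 'rV[R]_m) :
  differentiable h y /\ 'd h y = mulmx^~ (gradmx y) :> (_ -> _).
Proof.
pose L : {linear 'rV[R]_m -> 'rV[R]_s} := mulmxr (gradmx y).
have cL : continuous L.
  by move=> v; apply: (cvg_mulmx (F := nbhs v) (f := id)) cvg_id.
apply: (differentiable_linear_approx cL) => e e0.
have /(filterI (nbhs_right_gt 0))/filter_ex[r [r0 hr]] :=
  strictly_differentiable_gradmx y e0.
exists r => // d /ltW dr.
have := hr y (y + d); rewrite subrr normr0 opprD addrA subrr sub0r normrN.
have -> : y + d - y = d by rewrite addrAC subrr add0r.
by apply=> //; rewrite ltW.
Qed.

Lemma mul_jacobian (y d : 'rV[R]_m) j :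
  (d *m 'J h y) 0 j = dotp (grad (fun x => h x 0 j) y) d.
Proof. by rewrite mul_rV_lin1 (diff_C2_map y).2 mul_gradmx. Qed.

Lemma C2_map_strictly_differentiable (y : 'rV[R]_m) (e : R) : 0 < e ->
  \forall r \near 0^'+, forall x x' : 'rV[R]_m, `|y - x| <= r -> `|y - x'| <= r ->
    `|h x' - h x - (x' - x) *m 'J h y| <= e * `|x' - x|.
Proof.
have -> : 'J h y = gradmx y.
  by apply/row_matrixP => i; apply/rowP => j; rewrite !rowE mul_jacobian mul_gradmx.
exact: strictly_differentiable_gradmx.
Qed.

Lemma C2_map_taylor2 (y : 'rV[R]_m) (e : R) : 0 < e ->
  \forall r \near 0^'+, forall d : 'rV[R]_m, `|d| <= r ->
    `|h (y + d) - h y - d *m 'J h y - 2^-1 *: hess_map h y d d| <= e * `|d| ^+ 2.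
Proof.
move=> e0.
suff : \forall r \near (0 : R)^'+, forall j, forall d : 'rV[R]_m, `|d| <= r ->
    `|h (y + d) 0 j - h y 0 j - dotp (grad (fun x => h x 0 j) y) d -
      2^-1 * dotp (d *m hess (fun x => h x 0 j) y) d| <= e * `|d| ^+ 2.
  apply: filterS => r hr d dr.
  apply: norm_mx_le => [|i j]; first by rewrite mulr_ge0 ?exprn_ge0// ltW.
  by rewrite ord1; move: (hr j d dr); rewrite -mul_jacobian !mxE.
apply: filter_forall => j; have [df dg _] := C2h j.
exact: (taylor2 df (dg y) e0).
Qed.

End VectorMaps.

(* Simplified Newton iteration: [c |-> c - (h (x + c *m P) - z)] is a
   1/2-contraction of the closed ball of radius [2 * `|h x - z|]. *)
Lemma lyusternik (R : realType) m s (h : 'rV[R]_m -> 'rV[R]_s) (y : 'rV[R]_m)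
    (P : 'M[R]_(s, m)) :
  C2_map h -> P *m 'J h y = 1%:M ->
  exists2 C : R, 0 < C & exists2 r : R, 0 < r &
    forall (x : 'rV[R]_m) (z : 'rV[R]_s),
    `|y - x| < r -> `|h x - z| < r ->
    exists2 x' : 'rV[R]_m, h x' = z & `|x' - x| <= C * `|h x - z|.
Proof.
move=> C2h PJ; have [K K0 PK] := norm_mulmx_le 1 P.
(* Multiplication by [P] stretches by at most [K], so accuracy [1 / (2 K)] in the strict derivative
   makes the iteration contract by 1/2. *)
have K20 : 0 < (2 * K)^-1 by rewrite invr_gt0 mulr_gt0.
have /(filterI (nbhs_right_gt 0))/filter_ex[r0 [r00 hr0]] :=
  C2_map_strictly_differentiable C2h y K20.
exists (2 * K); first by rewrite mulr_gt0.
have K1 : 0 < 1 + 2 * K by rewrite ltr_wpDr// mulr_ge0// ltW.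
(* This radius keeps every [x + c *m P] with [c] in the ball within [r0] of [y], where the
   derivative estimate holds. *)
exists (r0 / (1 + 2 * K)) => [|x z yx hxz]; first exact: divr_gt0.
pose rho := 2 * `|h x - z|.
pose g (c : 'rV[R]_s) : 'rV[R]_s := c - (h (x + c *m P) - z).
have near_y (c : 'rV[R]_s) : `|c| <= rho -> `|y - (x + c *m P)| <= r0.
  move=> cr; rewrite opprD addrA (le_trans (ler_normB _ _))//.
  have -> : r0 = r0 / (1 + 2 * K) + 2 * K * (r0 / (1 + 2 * K)).
    by field; rewrite gt_eqF.
  rewrite lerD ?(ltW yx)// (le_trans (PK _))//.
  rewrite -[2 * K * (_ / _)]mulrA mulrCA ler_wpM2l ?(ltW K0)// (le_trans cr)//.
  by rewrite ler_wpM2l// ltW.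
have g_lip (c c' : 'rV[R]_s) : `|c| <= rho -> `|c'| <= rho ->
    `|g c' - g c| <= 2^-1 * `|c' - c|.
  move=> cr c'r; have := hr0 _ _ (near_y _ cr) (near_y _ c'r).
  have -> : x + c' *m P - (x + c *m P) = (c' - c) *m P.
    by rewrite mulmxBl opprD addrACA subrr add0r.
  rewrite -mulmxA PJ mulmx1 => le1.
  have -> : g c' - g c = - (h (x + c' *m P) - h (x + c *m P) - (c' - c)).
    by apply/rowP => i; rewrite !mxE; ring.
  rewrite normrN (le_trans le1)// invfM -mulrA ler_wpM2l//.
  by rewrite mulrC ler_pdivrMr// mulrC.
have rho0 : 0 <= rho by rewrite mulr_ge0.
have g_ball (c : 'rV[R]_s) : `|c| <= rho -> `|g c| <= rho.
  move=> cr; have := g_lip 0 c; rewrite normr0 subr0 => /(_ rho0 cr) le1.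
  rewrite -(subrK (g 0) (g c)) (le_trans (ler_normD _ _))//.
  (* [g 0] equals [z - h x], whose norm is half of [rho]. *)
  have -> : rho = 2^-1 * rho + `|g 0|.
    rewrite /g mul0mx addr0 sub0r normrN /rho; lra.
  by rewrite lerD// (le_trans le1)// ler_wpM2l.
pose U : set 'rV[R]_s := [set c | `|c| <= rho].
have gU : set_fun U U g by move=> c; exact: g_ball.
have Ucl : closed U.
  apply: (@closed_comp _ _ (fun c : 'rV[R]_s => `|c|) [set x | x <= rho]).
    by move=> c _; exact: norm_continuous.
  exact: closed_le.
have U0 : U !=set0 by exists 0; rewrite /U/= normr0.
have half0 : 0 <= 2^-1 :> R by rewrite invr_ge0.
have gctr : is_contraction (mkfun_fun gU).
  exists (NngNum half0); split; first by rewrite /= invf_lt1// ltr1n.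
  by move=> [c c'] [/= cU c'U]; exact: g_lip.
have [c cU cE] := banach_fixed_point gctr Ucl U0.
exists (x + c *m P).
  apply/eqP; rewrite -subr_eq0; apply/eqP.
  by rewrite -[RHS](subrr c) [X in c - X]cE /= /g opprB subrKC.
rewrite addrC addKr (le_trans (PK _))// [2 * K]mulrC -mulrA.
by rewrite ler_wpM2l// ltW.
Qed.

(** * One-sided limits, selections and lower limits *)

Section Limits.
Context {R : realType}.

(** At each [t > 0] one picks a point of [P t] whose distance to [l] is minimal up to a slack [t].
    This single choice serves all accuracies [e]. *)
Lemma selection_at_right (V : normedModType R) (P : R -> V -> Prop) (l : V) :
  (forall e : R, 0 < e -> \forall t \near 0^'+, exists2 z, P t z & `|z - l| <= e) ->
  exists2 f : R -> V, f t @[t --> 0^'+] --> l & \forall t \near 0^'+, P t (f t).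
Proof.
move=> Pl; pose S t := [set e | exists2 z, P t z & `|z - l| <= e].
have S_lb t : lbound (S t) 0 by move=> e [z _]; exact: le_trans.
pose Q t := [set z | P t z /\ `|z - l| <= inf (S t) + t].
have Qf t : 0 < t -> S t !=set0 -> Q t (xget l (Q t)).
  move=> t0 St0; have [|e [z Pz zl] et] := @inf_adherent _ (S t) _ t0.
    by split=> //; exists 0; exact: S_lb.
  by apply: (@xgetPex _ l (Q t)); exists z; split=> //; rewrite (le_trans zl)// ltW.
(* For [t > 0] the default [l] is taken only when [P t] has no point. *)
exists (fun t => xget l (Q t)).
- apply/cvgrPdist_le => e e0.
  have e20 : 0 < e / 2 by rewrite divr_gt0.
  have := Pl _ e20; apply: filterS2; last first.
    exact: filterI (nbhs_right_gt 0) (nbhs_right_le e20).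
  move=> t [t0 te] St; have [] := Qf t t0 _.
    by case: St => z Pz zl; exists (e / 2), z.
  move=> _ le1; rewrite distrC (le_trans le1)// [leRHS]splitr lerD//.
  apply: ge_inf; first by exists 0; exact: S_lb.
  by [].
- have := Pl _ ltr01; apply: filterS2; last exact: nbhs_right_gt.
  move=> t t0 [z Pz zl]; have [] := Qf t t0 => //; by exists 1, z.
Qed.

Lemma limf_einf_ge (T : choiceType) (X : filteredType T) (f : X -> \bar R)
    (F : set_system X) (a : \bar R) :
  (\forall x \near F, a <= f x)%E -> (a <= limf_einf f F)%E.
Proof.
move=> Fa; rewrite limf_einfE.
apply: (@le_trans _ _ (ereal_inf (f @` [set x | (a <= f x)%E]))).
  by apply: le_ereal_inf_tmp => _ [x ax <-].
by apply: ereal_sup_ubound; exists [set x | (a <= f x)%E].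
Qed.

(** An upper bound for a lower limit needs only one path into the filter: a recovery arc, or a
    sequence of epigraph points. *)
Lemma limf_einf_le_cvg (T : choiceType) (X : filteredType T) (f : X -> \bar R)
    (F : set_system X) I (G : set_system I) {GG : ProperFilter G} (g : I -> X)
    (u : I -> \bar R) (a : \bar R) :
  g @ G --> F -> (\forall i \near G, f (g i) <= u i)%E -> u @ G --> a ->
  (limf_einf f F <= a)%E.
Proof.
move=> gF fu ua; rewrite limf_einfE; apply: ge_ereal_sup => _ [A FA <-].
apply: (closed_cvg _ (@closed_ereal_le_ereal _ _) _ _ ua).
have := gF _ FA; apply: filterS2 fu => i fui Agi /=.
by apply: le_trans fui; apply: ereal_inf_lbound; exists (g i).
Qed.

Lemma cvg_at_rightW T (F : set_system T) (t : T -> R) (a : R) :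
  t @ F --> a^'+ -> t @ F --> a.
Proof. by move=> ta A Aa; apply: ta; exact: cvg_within Aa. Qed.

Lemma down_to0_cvg (t : nat -> R) : down_to0 t -> t @ \oo --> 0^'+.
Proof.
move=> [t0 tl] A /tl At.
have {}At : \forall k \near \oo, 0 < t k -> A (t k) := At.
suff : \forall k \near \oo, A (t k) by [].
by apply: filterS At => k; apply; exact: t0.
Qed.

Lemma down_to0_harmonic : down_to0 (@harmonic R).
Proof. by split; [move=> k; exact: harmonic_gt0|exact: cvg_harmonic]. Qed.

(* The shift makes an eventual property of a null sequence hold everywhere. *)
Lemma near_right_down_to0 (P : set R) : (\forall t \near 0^'+, P t) ->
  exists2 t : nat -> R, down_to0 t & forall k, P (t k).
Proof.
move=> /(down_to0_cvg down_to0_harmonic)[N _ NP].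
exists (fun k => harmonic (k + N)%N); last by move=> k; apply: NP; exact: leq_addl.
split=> [k|]; first exact: harmonic_gt0.
by have := @cvg_harmonic R; rewrite -(cvg_shiftn N).
Qed.

End Limits.

(** * Closed convex cones *)

Section ClosedConvexCone.
Context {R : realType} {n : nat} (Xi : set 'rV[R]_n).
Context (coneXi : closed_convex_cone Xi).
Implicit Types (a b x : 'rV[R]_n) (t r : R).

Lemma cone_scale t x : 0 <= t -> Xi x -> Xi (t *: x).
Proof.
have [_ _ Xi0 XiZ] := coneXi.
by rewrite le_eqVlt => /predU1P[<-|/XiZ/[apply]//]; rewrite scale0r.
Qed.

(** The sum is twice the midpoint. *)
Lemma cone_add a b : Xi a -> Xi b -> Xi (a + b).
Proof.
have [_ Xiconv _ _] := coneXi.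
move=> Xa Xb; have half0 : (0 <= 2^-1 :> R) by rewrite invr_ge0.
have half1 : (2^-1 <= 1 :> R) by rewrite invf_le1// ler1n.
have := Xiconv a b (Itv01 half0 half1).
rewrite !inE => /(_ Xa Xb)/(cone_scale (ler0n _ 2)).
suff -> : 2 *: (2^-1 *: a + (1 - 2^-1) *: b) = a + b by [].
by apply/rowP => i; rewrite !mxE; field.
Qed.

(** The point is a convex combination of [a] and [a + r *: b]. Thus membership at one parameter
    passes to all smaller ones, which turns sequences into arcs. *)
Lemma cone_shrink a b t r : Xi a -> Xi (a + r *: b) -> 0 <= t <= r ->
  Xi (a + t *: b).
Proof.
move=> Xa Xb /andP[t0]; rewrite le_eqVlt => /predU1P[->//|tr].
have r0 : 0 < r by apply: le_lt_trans tr.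
have -> : a + t *: b = (1 - t / r) *: a + (t / r) *: (a + r *: b).
  by apply/rowP => i; rewrite !mxE; field; rewrite gt_eqF.
apply: cone_add; apply: cone_scale => //; last by rewrite divr_ge0// ltW.
by rewrite subr_ge0 ler_pdivrMr// mul1r ltW.
Qed.

Lemma cone_scaleE t x : 0 < t -> Xi (t *: x) <-> Xi x.
Proof.
move=> t0; split=> [|Xx]; last by apply: cone_scale => //; exact: ltW.
move=> /(@cone_scale t^-1); rewrite scalerA mulVf ?scale1r ?gt_eqF// invr_ge0.
by apply; exact: ltW.
Qed.

End ClosedConvexCone.

Lemma cvg_rV (R : realType) n T (F : set_system T) {FF : Filter F}
    (f : T -> 'rV[R]_n) (l : 'rV[R]_n) :
  (forall j, f x 0 j @[x --> F] --> l 0 j) -> f @ F --> l.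
Proof.
move=> fl; apply/cvgrPdist_le => e e0.
have : \forall x \near F, forall j, `|l 0 j - f x 0 j| <= e.
  by apply: filter_forall => j; move/cvgrPdist_le: (fl j); apply.
apply: filterS => x fx; apply: norm_mx_le => [|i j]; first exact: ltW.
by rewrite ord1 !mxE.
Qed.

(** * The second-order remainder of [h] along converging directions *)

Section SecondOrderRemainder.
Context {R : realType} {m s : nat} (h : 'rV[R]_m -> 'rV[R]_s) (y : 'rV[R]_m).
Context (C2h : C2_map h) (hy0 : h y = 0).

(** This is the [B t u] of the opening comment. *)
Definition remainder2 (t : R) (u : 'rV[R]_m) : 'rV[R]_s :=
  (2^-1 * t ^+ 2)^-1 *: (h (y + t *: u) - t *: (u *m 'J h y)).

Lemma remainder2E t u : 0 < t ->
  h (y + t *: u) = t *: (u *m 'J h y + (2^-1 * t) *: remainder2 t u).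
Proof.
move=> t0; have tn0 := lt0r_neq0 t0.
apply/rowP => i; rewrite !mxE; field.
by rewrite ?tn0.
Qed.

Lemma cvg_remainder2 T (F : set_system T) {FF : Filter F} (t : T -> R)
    (u : T -> 'rV[R]_m) (w : 'rV[R]_m) :
  t @ F --> 0^'+ -> u @ F --> w ->
  remainder2 (t x) (u x) @[x --> F] --> hess_map h y w w.
Proof.
move=> t0 uw.
have Hu : hess_map h y (u x) (u x) @[x --> F] --> hess_map h y w w.
  apply: cvg_rV => j; rewrite mxE; under eq_fun do rewrite mxE.
  by apply: cvg_dotp => //; exact: cvg_mulmx.
have : remainder2 (t x) (u x) - hess_map h y (u x) (u x) @[x --> F] -->
      (0 : 'rV[R]_s).
  apply/cvgr0Pnorm_le => e e0.
  pose k : R := `|w| + 1.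
  have k0 : 0 < k by rewrite ltr_wpDl.
  (* This accuracy absorbs the eventual bound [k] on the directions, squared, and the division by
     half of [t ^+ 2]. *)
  have e'0 : 0 < e / (2 * k ^+ 2) by rewrite divr_gt0 ?mulr_gt0 ?exprn_gt0.
  have /(filterI (nbhs_right_gt 0))/filter_ex[r [r0 hr]] :=
    C2_map_taylor2 C2h y e'0.
  have tu0 : t x *: u x @[x --> F] --> 0 *: w.
    by apply: cvgZ => //; exact: cvg_at_rightW.
  rewrite scale0r in tu0.
  have Ft0 : \forall x \near F, 0 < t x := t0 _ (nbhs_right_gt 0).
  near=> x.
  have tx0 : 0 < t x by near: x; exact: Ft0.
  have uk : `|u x| <= k.
    near: x; move/cvgrPdist_le/(_ _ ltr01): uw; apply: filterS => x wu.
    by rewrite -(subrK w (u x)) (le_trans (ler_normD _ _))// addrC lerD// distrC.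
  have /hr : `|t x *: u x| <= r.
    near: x; move/cvgr0Pnorm_le/(_ _ r0): tu0; exact.
  rewrite hy0 subr0 -scalemxAl.
  have -> : hess_map h y (t x *: u x) (t x *: u x) =
      t x ^+ 2 *: hess_map h y (u x) (u x).
    apply/rowP => j; rewrite !mxE -scalemxAl dotpZr dotpC dotpZr dotpC; ring.
  move=> le1.
  have -> : remainder2 (t x) (u x) - hess_map h y (u x) (u x) =
    (2^-1 * t x ^+ 2)^-1 *: (h (y + t x *: u x) - t x *: (u x *m 'J h y) -
      2^-1 *: (t x ^+ 2 *: hess_map h y (u x) (u x))).
    rewrite scalerBr [2^-1 *: _]scalerA scalerA mulVf ?scale1r//.
    by rewrite mulf_neq0 ?invr_neq0 ?expf_neq0 ?gt_eqF.
  have t20 : 0 < 2^-1 * t x ^+ 2 by rewrite mulr_gt0 ?invr_gt0 ?exprn_gt0.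
  rewrite normrZ gtr0_norm ?invr_gt0// ler_pdivrMl// (le_trans le1)//.
  rewrite normrZ exprMn (gtr0_norm tx0).
  rewrite [leRHS](_ : _ = e / (2 * k ^+ 2) * (t x ^+ 2 * k ^+ 2)); last first.
    by field; rewrite gt_eqF.
  by rewrite ler_pM2l// ler_pM2l ?exprn_gt0// lerXn2r ?nnegrE// ltW.
by move=> rH; apply: (cvg_sub0 rH Hu).
Unshelve. all: end_near. Qed.

End SecondOrderRemainder.

Lemma cvg_add_scale0 (R : realType) (V : normedModType R) T (F : set_system T)
    {FF : Filter F} (a : V) (t : T -> R) (u : T -> V) (l : V) :
  t @ F --> (0 : R) -> u @ F --> l -> a + t x *: u x @[x --> F] --> a.
Proof.
move=> t0 ul; have := cvgD (cvg_cst a) (cvgZ t0 ul).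
by rewrite scale0r addr0; exact.
Qed.

Lemma cvg_half0 (R : realType) T (F : set_system T) {FF : Filter F} (t : T -> R) :
  t @ F --> (0 : R) -> 2^-1 * t x @[x --> F] --> (0 : R).
Proof.
move=> t0; have := cvgM (cvg_cst (2^-1 : R)) t0.
by rewrite mulr0; exact.
Qed.

(** * Membership in a reducible set and correction onto it *)

Section ConeReducible.
Context {R : realType} {m s : nat} (Omega : set 'rV[R]_m) (y : 'rV[R]_m).
Context (Xi : set 'rV[R]_s) (h : 'rV[R]_m -> 'rV[R]_s).
Context (red : C2_cone_reducible Omega y Xi h).

Let coneXi : closed_convex_cone Xi. Proof. by case: red. Qed.
Let C2h : C2_map h. Proof. by case: red. Qed.
Let hy0 : h y = 0. Proof. by case: red. Qed.

(** Row vectors are multiplied on the right, so rank [s] makes [J] surjective, and [z *m P] is a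
    preimage of [z]. *)
Definition rightinv_jacobian : 'M[R]_(s, m) := pinvmx ('J h y).
Local Notation J := ('J h y).
Local Notation P := rightinv_jacobian.

Lemma rightinv_jacobianK : P *m J = 1%:M.
Proof. by apply: mulVpmx; rewrite /row_full; case: red => _ _ _ _ ->. Qed.

Lemma reducible_near : \forall x \near y, Omega x <-> Xi (h x).
Proof.
have [_ _ [U yU OU] _ _] := red.
have /seteqP[OU1 OU2] := OU.
apply: filterS yU => x Ux; split=> [Ox|Xx].
  by have [] := OU1 x (conj Ox Ux).
by have [] := OU2 x (conj Ux Xx).
Qed.

Lemma lyusternik_reducible : exists2 C : R, 0 < C & exists2 r : R, 0 < r &
  forall (x : 'rV[R]_m) (z : 'rV[R]_s),
    `|y - x| < r -> `|h x - z| < r -> Xi z ->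
    exists2 x' : 'rV[R]_m, Omega x' & `|x' - x| <= C * `|h x - z|.
Proof.
have [C C0 [r r0 hr]] := lyusternik C2h rightinv_jacobianK.
have /nbhs_normP[q q0 qO] := reducible_near.
have C1 : 0 < 1 + C by rewrite ltr_wpDl// ltW.
(* The start is within [q / (1 + C)] of [y] and moves by at most [C] times that, so the corrected
   point stays where [Omega] is described by [Xi]. *)
exists C => //; exists (Num.min r (q / (1 + C))) => [|x z].
  by rewrite lt_min r0 divr_gt0.
rewrite !lt_min => /andP[yx yx'] /andP[xz xz'] Xz.
have [x' hx' xx'] := hr x z yx xz; have := xx'; rewrite distrC => x'x.
exists x' => //; apply/qO; last by rewrite hx'.
rewrite /= (le_lt_trans (ler_distD x _ _))//.
rewrite [ltRHS](_ : _ = q / (1 + C) + C * (q / (1 + C))); last first.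
  by field; rewrite gt_eqF.
by rewrite ltr_leD// (le_trans x'x)// ler_wpM2l ?ltW.
Qed.

(** By [remainder2E], [h] at the curve is [t] times the displayed vector, and a positive factor does
    not affect membership in a cone. *)
Lemma reducible_curve T (F : set_system T) {FF : Filter F} (t : T -> R)
    (u : T -> 'rV[R]_m) (w : 'rV[R]_m) :
  t @ F --> 0^'+ -> u @ F --> w -> \forall x \near F,
    Omega (y + t x *: u x) <->
    Xi (u x *m J + (2^-1 * t x) *: remainder2 h y (t x) (u x)).
Proof.
move=> t0 uw.
have yF : y + t x *: u x @[x --> F] --> y.
  exact: cvg_add_scale0 (cvg_at_rightW t0) uw.
have Ft0 : \forall x \near F, 0 < t x := t0 _ (nbhs_right_gt 0).
have FO : \forall x \near F, Omega (y + t x *: u x) <->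
  Xi (h (y + t x *: u x)) := yF _ reducible_near.
apply: filterS2 Ft0 FO => x tx Ox.
by rewrite Ox remainder2E// cone_scaleE.
Qed.

(** The target [t *: (w *m J + (2^-1 * t) *: b)] lies in [Xi] within [O(e t^2)] of [h] at the
    uncorrected parabola. The Lyusternik correction is then [O(e t^2)] as well and perturbs the
    coefficient [u] only by [O(e)]. *)
Lemma reducible_arc (w u : 'rV[R]_m) :
  (forall e : R, 0 < e -> \forall t \near 0^'+, exists2 b : 'rV[R]_s,
    Xi (w *m J + (2^-1 * t) *: b) &
    `|b - (u *m J + hess_map h y w w)| <= e) ->
  exists2 u_ : R -> 'rV[R]_m, u_ t @[t --> 0^'+] --> u &
    \forall t \near 0^'+, Omega (y + t *: w + (2^-1 * t ^+ 2) *: u_ t).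
Proof.
move=> bP; apply: (@selection_at_right _ _
  (fun t v => Omega (y + t *: w + (2^-1 * t ^+ 2) *: v))) => e e0.
have [C C0 [r r0 hr]] := lyusternik_reducible.
(* The target and the Taylor remainder each contribute [e'], and the correction multiplies their sum
   by [C]. *)
pose e' := e / (2 * C).
have e'0 : 0 < e' by rewrite divr_gt0// mulr_gt0.
have idt : (fun t : R => t) @ 0^'+ --> 0^'+ by exact: cvg_id.
have idt0 := cvg_at_rightW idt.
pose w' t := w + (2^-1 * t) *: u.
have w'w : w' t @[t --> 0^'+] --> w.
  apply: (cvg_add_scale0 _ (cvg_cst u)).
  exact: cvg_half0.
have x0 : y + t *: w' t @[t --> 0^'+] --> y by exact: cvg_add_scale0 w'w.
have : remainder2 h y t (w' t) @[t --> 0^'+] --> hess_map h y w w.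
  exact: cvg_remainder2.
move=> /cvgrPdist_le/(_ _ e'0) rem.
move/cvgrPdist_lt/(_ _ r0) : x0 => x0.
near=> t.
have t0 : 0 < t by near: t; exact: nbhs_right_gt.
have t20 : 0 < 2^-1 * t ^+ 2 by rewrite mulr_gt0 ?invr_gt0 ?exprn_gt0.
have [b Xb bb] : exists2 b : 'rV[R]_s, Xi (w *m J + (2^-1 * t) *: b) &
    `|b - (u *m J + hess_map h y w w)| <= e'.
  by near: t; exact: bP.
have hxz : `|h (y + t *: w' t) - t *: (w *m J + (2^-1 * t) *: b)| <=
    2^-1 * t ^+ 2 * (2 * e').
  rewrite remainder2E// -scalerBr.
  have -> : w' t *m J + (2^-1 * t) *: remainder2 h y t (w' t) -
      (w *m J + (2^-1 * t) *: b) =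
      (2^-1 * t) *: ((remainder2 h y t (w' t) - hess_map h y w w) -
        (b - (u *m J + hess_map h y w w))).
    by rewrite mulmxDl -scalemxAl; apply/rowP => i; rewrite !mxE; ring.
  rewrite scalerA normrZ mulrCA -expr2 gtr0_norm// ler_pM2l//.
  rewrite (le_trans (ler_normB _ _))// mulr2n mulrDl mul1r lerD//.
  by rewrite distrC; near: t; exact: rem.
have [| | |x' Ox' xx'] := hr (y + t *: w' t) (t *: (w *m J + (2^-1 * t) *: b)).
- by near: t; exact: x0.
- rewrite (le_lt_trans hxz)// mulrACA mulVf// mul1r.
  have t1 : t < 1 by near: t; exact: nbhs_right_lt.
  have tr : t < r / e' by near: t; apply: nbhs_right_lt; rewrite divr_gt0.
  rewrite -ltr_pdivlMr// (le_lt_trans _ tr)// expr2 ger_pMl// ltW//.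
- by apply: (cone_scale coneXi) => //; exact: ltW.
(* The coefficient for which the parabola hits [x'] at time [t]. *)
exists (u + (2^-1 * t ^+ 2)^-1 *: (x' - (y + t *: w' t))).
  rewrite [X in Omega X](_ : _ = x')//.
  by apply/rowP => i; rewrite !mxE; field; rewrite gt_eqF.
rewrite addrC addKr normrZ gtr0_norm ?invr_gt0// ler_pdivrMl//.
rewrite (le_trans xx')// (le_trans (ler_wpM2l (ltW C0) hxz))//.
rewrite mulrCA /e' [C * _](_ : _ = e)//.
by field; rewrite gt_eqF.
Unshelve. all: end_near. Qed.

End ConeReducible.

(** * First- and second-order tangents of a reducible set *)

Section TangentSets.
Context {R : realType} {m s : nat} (Omega : set 'rV[R]_m) (y : 'rV[R]_m).
Context (Xi : set 'rV[R]_s) (h : 'rV[R]_m -> 'rV[R]_s).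
Context (red : C2_cone_reducible Omega y Xi h).
Local Notation J := ('J h y).

Let coneXi : closed_convex_cone Xi. Proof. by case: red. Qed.
Let C2h : C2_map h. Proof. by case: red. Qed.
Let hy0 : h y = 0. Proof. by case: red. Qed.
Let Xi_closed : closed Xi. Proof. by case: coneXi. Qed.

(** The choice [u *m J = - hess_map h y w w] makes the limit of [b] in [reducible_arc] zero, so
    [b = 0] works for every [t]. *)
Lemma reducible_critical_arc (w : 'rV[R]_m) : Xi (w *m J) ->
  exists (u : 'rV[R]_m) (u_ : R -> 'rV[R]_m),
    [/\ u *m J = - hess_map h y w w, u_ t @[t --> 0^'+] --> u &
      \forall t \near 0^'+, Omega (y + t *: w + (2^-1 * t ^+ 2) *: u_ t)].
Proof.
move=> Xw; pose u := - hess_map h y w w *m rightinv_jacobian y h.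
have uJ : u *m J = - hess_map h y w w.
  by rewrite -mulmxA (rightinv_jacobianK red) mulmx1.
have [|u_ u_u Ou] := reducible_arc red (w := w) (u := u); last by exists u, u_.
move=> e e0; apply: nearW => t; exists 0; first by rewrite scaler0 addr0.
by rewrite uJ addNr subrr normr0 ltW.
Qed.

Lemma cvg_reducible_curve T (F : set_system T) {FF : Filter F} (t : T -> R)
    (u : T -> 'rV[R]_m) (w : 'rV[R]_m) :
  t @ F --> 0^'+ -> u @ F --> w ->
  u x *m J + (2^-1 * t x) *: remainder2 h y (t x) (u x) @[x --> F] --> w *m J.
Proof.
move=> t0 uw; suff : u x *m J + (2^-1 * t x) *: remainder2 h y (t x) (u x)
    @[x --> F] --> w *m J + 0 *: hess_map h y w w by rewrite scale0r addr0.
apply: cvgD; first exact: cvg_mulmx.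
apply: cvgZ; last exact: cvg_remainder2.
by apply: cvg_half0; exact: cvg_at_rightW.
Qed.

(** One inclusion passes to the limit in the closed [Xi]; the other samples the arc of
    [reducible_critical_arc]. *)
Lemma tangent_cone_reducible (w : 'rV[R]_m) :
  tangent_cone Omega y w <-> Xi (w *m J).
Proof.
split=> [[t [w_ [dt w_w Ow]]]|Xw].
  have lim : w_ k *m J + (2^-1 * t k) *: remainder2 h y (t k) (w_ k)
    @[k --> \oo] --> w *m J by exact: cvg_reducible_curve (down_to0_cvg dt) w_w.
  apply: (closed_cvg _ Xi_closed _ _ lim).
  by apply: filterS (reducible_curve red (down_to0_cvg dt) w_w) => k /= <-.
have [u [u_ [_ u_u /near_right_down_to0[t dt Ot]]]] := reducible_critical_arc Xw.
exists t, (fun k => w + (2^-1 * t k) *: u_ (t k)); split=> // [|k].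
  apply: cvg_add_scale0 (cvg_half0 dt.2) (cvg_comp _ _ (down_to0_cvg dt) u_u).
have := Ot k; rewrite expr2 mulrA scalerDr scalerA [t k * _]mulrC.
by rewrite addrA.
Qed.

(** Upgrades a sequence to an arc. For each accuracy a single late index [k] gives a suitable [b k],
    and [cone_shrink] reuses it for all smaller times because [w *m J] is itself in [Xi]. *)
Lemma second_order_tangent_reducible (w u : 'rV[R]_m) : Xi (w *m J) ->
  second_order_tangent_set Omega y w u ->
  exists2 u_ : R -> 'rV[R]_m, u_ t @[t --> 0^'+] --> u &
    \forall t \near 0^'+, Omega (y + t *: w + (2^-1 * t ^+ 2) *: u_ t).
Proof.
move=> Xw [t [u_ [dt u_u Ou]]].
pose w_ k := w + (2^-1 * t k) *: u_ k.
have w_w : w_ @ \oo --> w.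
  by apply: cvg_add_scale0 u_u; exact: cvg_half0 dt.2.
have Ow : \forall k \near \oo, Omega (y + t k *: w_ k) <->
    Xi (w_ k *m J + (2^-1 * t k) *: remainder2 h y (t k) (w_ k)).
  by have := reducible_curve red (down_to0_cvg dt) w_w; apply.
pose b k := u_ k *m J + remainder2 h y (t k) (w_ k).
have b_lim : b @ \oo --> u *m J + hess_map h y w w.
  apply: cvgD; first exact: cvg_mulmx.
  exact: cvg_remainder2 (down_to0_cvg dt) w_w.
apply: (reducible_arc red) => e e0.
move/cvgrPdist_le/(_ _ e0) : b_lim => /(filterI Ow)/filter_ex[k [/= Owk be]].
have tk0 := dt.1 k.
have := nbhs_right_le tk0; apply: filterS2 (nbhs_right_gt 0) => r r0 rt.
exists (b k); last by rewrite distrC.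
apply: (cone_shrink coneXi (r := 2^-1 * t k)) => //; last first.
  by rewrite mulr_ge0 ?ler_wpM2l// ltW.
rewrite (_ : _ + _ = w_ k *m J + (2^-1 * t k) *: remainder2 h y (t k) (w_ k)).
  apply/Owk; have := Ou k; rewrite /w_ scalerDr scalerA addrA.
  by rewrite expr2 mulrCA mulrA.
by rewrite /b scalerDr addrA /w_ mulmxDl -scalemxAl.
Qed.

Lemma reducible_parabolically_derivable (w : 'rV[R]_m) : Xi (w *m J) ->
  parabolically_derivable Omega y w.
Proof.
move=> Xw; split.
  have [u [u_ [_ u_u /near_right_down_to0[t dt Ot]]]] := reducible_critical_arc Xw.
  exists u, t, (u_ \o t); split=> //.
  exact: cvg_comp (down_to0_cvg dt) u_u.
move=> u /(second_order_tangent_reducible Xw)[u_ u_u Ou].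
pose xi t := y + t *: w + (2^-1 * t ^+ 2) *: u_ t.
(* The factor [t ^+ 2] cancels the arbitrary value [u_ 0]. *)
have xi0 : xi 0 = y by rewrite /xi scale0r expr0n mulr0 scale0r !addr0.
have Oy : Omega y.
  apply/(nbhs_singleton (reducible_near red)); rewrite hy0.
  by case: coneXi.
have [e e0 eO] : exists2 e : R, 0 < e & forall t, 0 < t <= e -> Omega (xi t).
  have [e /= e0 eO] := Ou; exists (e / 2); first by rewrite divr_gt0.
  move=> t /andP[t0 te]; apply: eO => //=.
  rewrite sub0r normrN gtr0_norm// (le_lt_trans te)// ltr_pdivrMr//.
  by rewrite ltr_pMr// ltr1n.
exists e, xi; split => //.
- move=> t /andP[]; rewrite le_eqVlt => /predU1P[<- _|t0 te].
    by rewrite xi0.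
  by apply: eO; rewrite t0.
- have : w + (2^-1 * t) *: u_ t @[t --> 0^'+] --> w.
    by apply: cvg_add_scale0 u_u; apply: cvg_half0; exact: cvg_at_rightW cvg_id.
  apply: cvg_trans; apply: near_eq_cvg.
  have := nbhs_right_gt (0 : R); apply: filterS => t t0.
  by apply/rowP => i; rewrite xi0 !mxE; field; rewrite gt_eqF.
- move: u_u; apply: cvg_trans; apply: near_eq_cvg.
  have := nbhs_right_gt (0 : R); apply: filterS => t t0.
  by apply/rowP => i; rewrite xi0 !mxE; field; rewrite gt_eqF.
Qed.

End TangentSets.

(** * Regular and limiting normals *)

Section Normals.
Context {R : realType} {n : nat}.
Implicit Types (Omega Xi : set 'rV[R]_n) (x v : 'rV[R]_n).

(** The upper limit is unfolded into an inequality; the point [z = x], excluded from the punctured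
    filter, satisfies it trivially. *)
Lemma regular_normal_le Omega x v (e : R) :
  regular_normal_cone Omega x v -> 0 < e ->
  \forall z \near x, Omega z -> dotp v (z - x) <= e * enorm (z - x).
Proof.
move=> vN e0; have := le_lt_trans vN (_ : (0 < e%:E)%E).
rewrite lte_fin => /(_ e0); rewrite limf_esupE.
move=> /ereal_inf_lt[_ [V xV <-] Ve].
have {}xV : \forall z \near x, z != x -> Omega z -> V z := xV.
apply: filterS xV => z zV Oz.
have [->|zx] := eqVneq z x.
  by rewrite subrr dotp0r mulr_ge0 ?enorm_ge0// ltW.
rewrite -ler_pdivrMr; last first.
  by rewrite (lt_le_trans _ (norm_le_enorm _))// normr_gt0 subr_eq0.
rewrite -lee_fin (le_trans _ (ltW Ve))//.
by apply: ereal_sup_ubound; exists z => //; exact: zV.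
Qed.

(** Constant sequences suffice, the quotient being nonpositive on all of [Xi]. *)
Lemma polar_normal_cone Xi x v :
  Xi x -> (forall z, Xi z -> dotp v (z - x) <= 0) -> normal_cone Xi x v.
Proof.
move=> Xx vXi; exists (fun=> x), (fun=> v); split=> //; [exact: cvg_cst|exact: cvg_cst|].
move=> k; rewrite /regular_normal_cone /= limf_esupE.
apply: (@le_trans _ _ (ereal_sup
  ((fun z => (dotp v (z - x) / enorm (z - x))%:E) @` Xi))).
  apply: ereal_inf_lbound; exists Xi => //.
  by apply: (@nearW _ (nbhs x)).
apply: ge_ereal_sup => _ [z Xz <-]; rewrite lee_fin.
by rewrite mulr_le0_ge0 ?invr_ge0 ?enorm_ge0// vXi.
Qed.

End Normals.

(** * Polarity of normals to a reducible set *)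

Section NormalsOfReducible.
Context {R : realType} {m s : nat} (Omega : set 'rV[R]_m) (y : 'rV[R]_m).
Context (Xi : set 'rV[R]_s) (h : 'rV[R]_m -> 'rV[R]_s).
Context (red : C2_cone_reducible Omega y Xi h).
Local Notation J := ('J h y).

Let coneXi : closed_convex_cone Xi. Proof. by case: red. Qed.
Let C2h : C2_map h. Proof. by case: red. Qed.
Let hy0 : h y = 0. Proof. by case: red. Qed.

(* For [x] in [Omega] near [y] and [h] moving in the direction [d *m J], which
   lies in [Xi], the point [x + t *: d] is corrected to a point of [Omega]
   within [o(t)], where the regular normal inequality at [x] applies. *)
Lemma reducible_normal_polar (lambda d : 'rV[R]_m) :
  normal_cone Omega y lambda -> Xi (d *m J) -> dotp lambda d <= 0.
Proof.
move=> [x_ [v_ [x_y Ox v_l vN]]] Xd.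
have [C C0 [r r0 hr]] := lyusternik_reducible red.
(* The part [1 + C] comes from the length of [x' - x], the part [(|lambda| + 1) * C] from pairing
   [v] with the correction. *)
pose K : R := m%:R * `|d| * (1 + C + (`|lambda| + 1) * C).
have K0 : 0 <= K.
  by rewrite !mulr_ge0 ?addr_ge0// ?mulr_ge0 ?addr_ge0// ltW.
(* Letting [e] tend to 0 suffices; [e <= 1] keeps the error in [h] below [t] times the norm of
   [d]. *)
suff leK (e : R) : 0 < e <= 1 -> dotp lambda d <= e * K.
  apply/ler_addgt0Pr => e e0; rewrite add0r.
  pose e' := Num.min 1 (e / (K + 1)).
  have K1 : 0 < K + 1 by rewrite ltr_wpDl.
  have e'0 : 0 < e' by rewrite lt_min ltr01 divr_gt0.
  rewrite (le_trans (leK e' _))//; first by rewrite e'0 ge_min lexx.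
  apply: (@le_trans _ _ (e / (K + 1) * (K + 1))); last by rewrite divfK// gt_eqF.
  apply: ler_pM => //; first exact: ltW.
    by rewrite ge_min lexx orbT.
  by rewrite lerDl.
move=> /andP[e0 e1].
have /(filterI (nbhs_right_gt 0))/filter_ex[r1 [r10 hr1]] :=
  C2_map_strictly_differentiable C2h y e0.
have lim : dotp (v_ k) d @[k --> \oo] --> dotp lambda d.
  by apply: cvg_dotp => //; exact: cvg_cst.
(* The bound is proved for [v_ k] with [k] large and passes to the limit [lambda]. *)
apply: (closed_cvg _ (@closed_le _ (e * K)) _ _ lim) => /=.
have minr0 : 0 < Num.min r r1 / 2 by rewrite divr_gt0// lt_min r0.
have XO : \forall k \near \oo, Omega (x_ k) <-> Xi (h (x_ k)).
  exact: x_y _ (reducible_near red).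
move/cvgrPdist_lt/(_ _ minr0) : x_y => x_y.
move/cvgrPdist_le/(_ _ ltr01) : v_l => v_l.
near=> k.
have yx : `|y - x_ k| < Num.min r r1 / 2 by near: k; exact: x_y.
have Xx : Xi (h (x_ k)).
  suff <- : Omega (x_ k) <-> Xi (h (x_ k)) by exact: Ox.
  by near: k; exact: XO.
have vk : `|v_ k| <= `|lambda| + 1.
  rewrite -lerBlDl (le_trans (lerB_dist _ _))// distrC.
  by near: k; exact: v_l.
have /nbhs_normP[q /= q0 vq] := regular_normal_le (vN k) e0.
set x := x_ k in Xx yx vq *; set v := v_ k in vk vq *.
(* [t * M] dominates both the step [t *: d] and [x' - x], so a small [t] keeps all points within the
   required radii. *)
pose M : R := `|d| * (1 + C) + 1.
have M0 : 0 < M by rewrite ltr_wpDl// mulr_ge0// addr_ge0// ltW.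
have a0 : 0 < Num.min q (Num.min r r1 / 2) by rewrite lt_min q0.
have /(filterI (nbhs_right_gt 0))/filter_ex[t [t0]] :=
  nbhs_right_lt (divr_gt0 a0 M0).
rewrite ltr_pdivlMr// lt_min => /andP[tq trr].
have td : t * `|d| * (1 + C) <= t * M.
  by rewrite -mulrA ler_wpM2l ?(ltW t0)// lerDl.
have td0 : 0 <= t * `|d| by rewrite mulr_ge0// ltW.
have td1 : t * `|d| <= t * M.
  by rewrite (le_trans _ td)// ler_peMr// lerDl ltW.
have yxtd : `|y - (x + t *: d)| < Num.min r r1.
  rewrite opprD addrA (le_lt_trans (ler_normB _ _))// [ltRHS]splitr ltrD//.
  by rewrite normrZ gtr0_norm// (le_lt_trans td1).
move: (yxtd); rewrite lt_min => /andP[yxr yxr1].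
have half_lt : Num.min r r1 / 2 < Num.min r r1.
  by rewrite ltr_pdivrMr// ltr_pMr ?ltr1n// lt_min r0.
have step : `|h (x + t *: d) - (h x + t *: (d *m J))| <= e * (t * `|d|).
  rewrite opprD addrA; have := hr1 x (x + t *: d).
  have -> : x + t *: d - x = t *: d by rewrite addrAC subrr add0r.
  rewrite -scalemxAl normrZ.
  rewrite gtr0_norm//; apply; last exact: ltW.
  by rewrite (le_trans (ltW yx))// (le_trans (ltW half_lt))// ge_min lexx orbT.
have [| | |x' Ox' xx'] := hr (x + t *: d) (h x + t *: (d *m J)).
- exact: yxr.
- rewrite (le_lt_trans step)// (le_lt_trans (ler_piMl td0 e1))//.
  rewrite (le_lt_trans td1)// (lt_trans trr)// (lt_le_trans half_lt)//.
  by rewrite ge_min lexx.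
- by apply: (cone_add coneXi) => //; apply: (cone_scale coneXi) => //; exact: ltW.
have {}xx' : `|x' - (x + t *: d)| <= C * (e * (t * `|d|)).
  by rewrite (le_trans xx')// ler_wpM2l// ltW.
have xE : x' - x = t *: d + (x' - (x + t *: d)).
  by apply/rowP => i; rewrite !mxE; ring.
have x'x : `|x' - x| <= t * `|d| * (1 + C).
  rewrite xE (le_trans (ler_normD _ _))// normrZ gtr0_norm//.
  rewrite mulrDr mulr1 lerD// (le_trans xx')//.
  by rewrite mulrC ler_wpM2r ?(ltW C0)// ler_piMl.
have /vq/(_ Ox') : `|x - x'| < q.
  by rewrite distrC (le_lt_trans x'x)// (le_lt_trans td).
move=> vle; rewrite -(ler_pM2l t0).
(* The first term is bounded by the normal inequality at [x], the second by the size of the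
   correction. *)
have -> : t * dotp v d = dotp v (x' - x) - dotp v (x' - (x + t *: d)).
  by rewrite {1}xE (dotpDr v (t *: d)) dotpZr addrK.
rewrite (_ : t * (e * K) = e * (m%:R * (t * `|d| * (1 + C))) +
  m%:R * (`|lambda| + 1) * (C * (e * (t * `|d|)))); last first.
  by rewrite /K; ring.
apply: lerD.
  rewrite (le_trans vle)// ler_wpM2l ?(ltW e0)// (le_trans (enorm_le _))//.
  by rewrite ler_wpM2l.
rewrite -dotpNr (le_trans (ler_norm _))// (le_trans (norm_dotp_le _ _))// normrN.
by rewrite ler_pM// ler_wpM2l.
Unshelve. all: end_near. Qed.

End NormalsOfReducible.

(** The inner limit is tested on the harmonic sequence, shifted so that membership holds at every
    index. *)
Lemma inner_outer_limit (R : realType) (E : topologicalType) (C : R -> set E) :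
  inner_limit C `<=` outer_limit C.
Proof.
move=> z /(_ _ (@down_to0_harmonic R))[z_ [z_z [N _ Cz]]].
exists (fun k => harmonic (k + N)%N), (fun k => z_ (k + N)%N); split.
- split=> [k|]; first exact: harmonic_gt0.
  by have := @cvg_harmonic R; rewrite -(cvg_shiftn N).
- exact: cvg_comp (@cvg_addnr N) z_z.
- by move=> k; apply: Cz; exact: leq_addl.
Qed.

Lemma diff_quotient2_indicator (R : realType) n (Omega : set 'rV[R]_n)
    (x v u : 'rV[R]_n) (t : R) : Omega x -> 0 < t ->
  diff_quotient2 (indicator_fun Omega) x v t u =
  if `[< Omega (x + t *: u) >] then (- (2 / t * dotp v u))%:E else +oo%E.
Proof.
move=> Ox t0; rewrite /diff_quotient2 /indicator_fun (asboolT Ox).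
rewrite sube0; case: ifPn => _.
  by rewrite sub0e -EFinN -EFinM; congr (_%:E); field; rewrite gt_eqF.
by rewrite addye// gt0_mulye// lte_fin invr_gt0 mulr_gt0 ?invr_gt0 ?exprn_gt0.
Qed.

(** * The multiplier and the formula for the second subderivative *)

Section SecondSubderivative.
Context {R : realType} {m s : nat} (Omega : set 'rV[R]_m) (y : 'rV[R]_m).
Context (Xi : set 'rV[R]_s) (h : 'rV[R]_m -> 'rV[R]_s) (lambda : 'rV[R]_m).
Context (Oy : Omega y) (red : C2_cone_reducible Omega y Xi h).
Context (Nlambda : normal_cone Omega y lambda).
Local Notation J := ('J h y).
Local Notation P := (rightinv_jacobian y h).
Local Notation d2 := (second_subderivative (indicator_fun Omega) y lambda).
Local Notation quot := (diff_quotient2 (indicator_fun Omega) y lambda).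

Let coneXi : closed_convex_cone Xi. Proof. by case: red. Qed.
Let C2h : C2_map h. Proof. by case: red. Qed.
Let hy0 : h y = 0. Proof. by case: red. Qed.
Let Xi_closed : closed Xi. Proof. by case: coneXi. Qed.
Let Xi0 : Xi 0. Proof. by case: coneXi. Qed.

(** If [lambda = mu' *m J^T], then [P *m J = 1%:M] gives [lambda *m P^T = mu'], so this is the only
    candidate. *)
Definition multiplier : 'rV[R]_s := lambda *m P^T.
Local Notation mu := multiplier.
Local Notation value w := (dotp mu (hess_map h y w w)).

Lemma multiplier_polar (z : 'rV[R]_s) : Xi z -> dotp mu z <= 0.
Proof.
move=> Xz; rewrite /mu -dotp_mulmxr; apply: (reducible_normal_polar red Nlambda).
by rewrite -mulmxA (rightinv_jacobianK red) mulmx1.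
Qed.

(** [lambda] vanishes on the kernel of [J], since both [v] and [- v] are mapped to [0], a point of
    [Xi]; and [d - d *m J *m P] lies in that kernel. *)
Lemma multiplierE : lambda = mu *m J^T.
Proof.
apply: dotp_inj => d; rewrite -dotp_mulmxr /mu -dotp_mulmxr.
have kerJ (v : 'rV[R]_m) : v *m J = 0 -> dotp lambda v <= 0.
  by move=> vJ; apply: (reducible_normal_polar red Nlambda); rewrite vJ.
pose v := d - d *m J *m P.
have vJ : v *m J = 0.
  by rewrite /v mulmxBl -[X in _ - X]mulmxA (rightinv_jacobianK red) mulmx1 subrr.
apply/eqP; rewrite -subr_eq0 -dotpBr eq_le kerJ//= -oppr_le0 -dotpNr kerJ//.
by rewrite mulNmx vJ oppr0.
Qed.

Lemma dotp_multiplier (u : 'rV[R]_m) : dotp lambda u = dotp mu (u *m J).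
Proof. by rewrite dotp_mulmxr -multiplierE. Qed.

Lemma multiplier_unique :
  unique (fun mu' : 'rV[R]_s => lambda = mu' *m J^T /\ normal_cone Xi (h y) mu') mu.
Proof.
split=> [|mu' [lE _]].
  split; first exact: multiplierE.
  apply: polar_normal_cone; rewrite hy0// => z.
  by rewrite subr0; exact: multiplier_polar.
rewrite /mu lE -mulmxA -trmx_mul (rightinv_jacobianK red) trmx1 mulmx1//.
Qed.

Lemma critical_coneE (w : 'rV[R]_m) :
  critical_cone Omega y lambda w <-> Xi (w *m J) /\ dotp lambda w = 0.
Proof. by split=> -[/(tangent_cone_reducible red)]. Qed.

Lemma second_subderivative_ge (w : 'rV[R]_m) : ((value w)%:E <= d2 w)%E.
Proof.
apply/lee_addgt0Pr => e e0; rewrite -leeBlDr// -EFinB; apply: limf_einf_ge.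
pose F := filter_prod (0 : R)^'+ (nbhs w).
have t0 : fst @ F --> (0 : R)^'+ by exact: cvg_fst.
have uw : snd @ F --> w by exact: cvg_snd.
have lim : dotp mu (remainder2 h y p.1 p.2) @[p --> F] --> value w.
  by apply: cvg_dotp; [exact: cvg_cst|exact: cvg_remainder2].
have Ft0 : \forall p \near F, 0 < p.1 := t0 _ (nbhs_right_gt 0).
have FO : \forall p \near F, Omega (y + p.1 *: p.2) <->
    Xi (p.2 *m J + (2^-1 * p.1) *: remainder2 h y p.1 p.2).
  by have := reducible_curve red t0 uw; apply.
move/cvgrPdist_le/(_ _ e0) : lim => lim.
near=> p.
have p0 : 0 < p.1 by near: p; exact: Ft0.
rewrite diff_quotient2_indicator//; case: ifPn => [/asboolP Op|_]; last first.
  by rewrite leey.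
have [Xp _] : Omega (y + p.1 *: p.2) <->
    Xi (p.2 *m J + (2^-1 * p.1) *: remainder2 h y p.1 p.2).
  by near: p; exact: FO.
have := multiplier_polar (Xp Op); rewrite dotpDr dotpZr -dotp_multiplier => le0.
have dist : `|value w - dotp mu (remainder2 h y p.1 p.2)| <= e.
  by near: p; exact: lim.
rewrite lee_fin (@le_trans _ _ (dotp mu (remainder2 h y p.1 p.2)))//.
  by rewrite lerBlDr -lerBlDl (le_trans (ler_norm _)).
rewrite -subr_ge0; set B := dotp mu _ in le0 *; set l := dotp lambda _ in le0 *.
(* A product of two nonpositive factors, the second by polarity of [mu]. *)
have -> : - (2 / p.1 * l) - B = - (2 / p.1) * (l + 2^-1 * p.1 * B).
  by field; rewrite gt_eqF.
by rewrite mulr_le0// oppr_le0 divr_ge0// ltW.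
Unshelve. all: end_near. Qed.

(** If [w *m J] is in [Xi], then [dotp lambda w < 0] and the quotient grows like [1 / t]. Otherwise
    closedness of [Xi] keeps nearby points [y + t u] out of [Omega]. *)
Lemma second_subderivative_noncritical (w : 'rV[R]_m) :
  ~ critical_cone Omega y lambda w -> d2 w = +oo%E.
Proof.
move=> ncw; apply: eq_infty => c; apply: limf_einf_ge.
pose F := filter_prod (0 : R)^'+ (nbhs w).
have t0 : fst @ F --> (0 : R)^'+ by exact: cvg_fst.
have uw : snd @ F --> w by exact: cvg_snd.
have Ft0 : \forall p \near F, 0 < p.1 := t0 _ (nbhs_right_gt 0).
have [Xw|nXw] := pselect (Xi (w *m J)).
  have lw : dotp lambda w < 0.
    rewrite lt_neqAle dotp_multiplier multiplier_polar// andbT.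
    apply/eqP => lw; apply: ncw; apply/critical_coneE; split=> //.
    by rewrite dotp_multiplier.
  (* The first tolerance makes the quotient at least [- dotp lambda w / t]; the bound on [t] below
     makes that at least [|c| + 1]. *)
  have l20 : 0 < - dotp lambda w / 2 by rewrite divr_gt0// oppr_gt0.
  have c1 : 0 < `|c| + 1 by rewrite ltr_wpDl.
  have lc0 : 0 < - dotp lambda w / (`|c| + 1) by rewrite divr_gt0// oppr_gt0.
  have lim : dotp lambda p.2 @[p --> F] --> dotp lambda w.
    by apply: cvg_dotp => //; exact: cvg_cst.
  move/cvgrPdist_le/(_ _ l20) : lim => lim.
  have Ftc : \forall p \near F, p.1 <= - dotp lambda w / (`|c| + 1) :=
    t0 _ (nbhs_right_le lc0).
  near=> p.
  have p0 : 0 < p.1 by near: p; exact: Ft0.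
  rewrite diff_quotient2_indicator//; case: ifPn => _; last by rewrite leey.
  have pc : p.1 <= - dotp lambda w / (`|c| + 1) by near: p; exact: Ftc.
  have dist : `|dotp lambda w - dotp lambda p.2| <= - dotp lambda w / 2.
    by near: p; exact: lim.
  have le1 : dotp lambda p.2 <= dotp lambda w / 2.
    by move: dist; rewrite ler_distl => /andP[+ _]; lra.
  rewrite lee_fin (@le_trans _ _ (- dotp lambda w / p.1))//.
    rewrite ler_pdivlMr// (@le_trans _ _ ((`|c| + 1) * p.1))//.
      by rewrite ler_pM2r// (le_trans (ler_norm _))// lerDl.
    by rewrite mulrC -ler_pdivlMr.
  rewrite mulNr lerN2 mulrAC ler_pM2r ?invr_gt0//; lra.
have Xlim : p.2 *m J + (2^-1 * p.1) *: remainder2 h y p.1 p.2 @[p --> F] -->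
    w *m J by have := cvg_reducible_curve red t0 uw; apply.
have FO : \forall p \near F, Omega (y + p.1 *: p.2) <->
    Xi (p.2 *m J + (2^-1 * p.1) *: remainder2 h y p.1 p.2).
  by have := reducible_curve red t0 uw; apply.
have FX : \forall p \near F,
    ~ Xi (p.2 *m J + (2^-1 * p.1) *: remainder2 h y p.1 p.2).
  apply: Xlim (~` Xi) _; apply: open_nbhs_nbhs; split=> //.
  exact: closed_openC.
apply: filterS3 Ft0 FO FX => p p0 Op nXp.
by rewrite diff_quotient2_indicator// asboolF ?leey// Op.
Unshelve. all: end_near. Qed.

(** Since [dotp lambda w = 0], the [1 / t] term of the quotient drops out along the critical arc.
    The arc is defined for all small [t], as epi-convergence demands. *)
Lemma critical_recovery (w : 'rV[R]_m) : critical_cone Omega y lambda w ->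
  exists2 u_ : R -> 'rV[R]_m, - dotp lambda (u_ t) @[t --> 0^'+] --> value w &
    (exists u : 'rV[R]_m, u_ t @[t --> 0^'+] --> u) /\
    \forall t \near 0^'+,
      quot t (w + (2^-1 * t) *: u_ t) = (- dotp lambda (u_ t))%:E.
Proof.
move=> /critical_coneE[Xw lw].
have [u [u_ [uJ u_u Ou]]] := reducible_critical_arc red Xw.
exists u_.
  have -> : value w = - dotp lambda u by rewrite dotp_multiplier uJ dotpNr opprK.
  by apply: cvgN; apply: cvg_dotp => //; exact: cvg_cst.
split; first by exists u.
have := nbhs_right_gt (0 : R); apply: filterS2 Ou => t Ot t0.
rewrite diff_quotient2_indicator// asboolT.
  by rewrite dotpDr lw add0r dotpZr; congr (_%:E); field; rewrite gt_eqF.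
by move: Ot; rewrite scalerDr scalerA addrA expr2 mulrCA mulrA.
Qed.

Lemma second_subderivativeE (w : 'rV[R]_m) :
  d2 w = if `[< critical_cone Omega y lambda w >] then (value w)%:E else +oo%E.
Proof.
case: ifPn => [/asboolP cw|/asboolP]; last exact: second_subderivative_noncritical.
apply/eqP; rewrite eq_le second_subderivative_ge andbT.
have [u_ lim [[u u_u] quotE]] := critical_recovery cw.
apply: (limf_einf_le_cvg (G := 0^'+) (g := fun t => (t, w + (2^-1 * t) *: u_ t))
  (u := fun t => (- dotp lambda (u_ t))%:E)).
- have w_w : w + (2^-1 * t) *: u_ t @[t --> 0^'+] --> w.
    by apply: cvg_add_scale0 u_u; apply: cvg_half0; exact: cvg_at_rightW cvg_id.
  by have := cvg_pair (@cvg_id _ (0 : R)^'+) w_w; apply.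
- by apply: filterS quotE => t /= ->.
- by apply/fine_cvgP; split; [exact: nearW|exact: lim].
Qed.

End SecondSubderivative.

(** * Parabolic regularity and twice epi-differentiability *)

Section TwiceEpiDifferentiability.
Context {R : realType} {m s : nat} (Omega : set 'rV[R]_m) (y : 'rV[R]_m).
Context (Xi : set 'rV[R]_s) (h : 'rV[R]_m -> 'rV[R]_s) (lambda : 'rV[R]_m).
Context (Oy : Omega y) (red : C2_cone_reducible Omega y Xi h).
Context (Nlambda : normal_cone Omega y lambda).
Local Notation d2 := (second_subderivative (indicator_fun Omega) y lambda).
Local Notation mu := (multiplier y h lambda).
Local Notation value w := (dotp mu (hess_map h y w w)).

Let d2E := second_subderivativeE Oy red Nlambda.

Lemma reducible_parabolically_regular : parabolically_regular Omega y lambda.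
Proof.
move=> w; rewrite d2E; case: ifPn => [/asboolP cw _|_]; last by rewrite ltxx.
have [u_ lim [[u u_u] quotE]] := critical_recovery Oy red Nlambda cw.
have [t dt tE] := near_right_down_to0 quotE.
have ut : u_ (t k) @[k --> \oo] --> u by exact: cvg_comp (down_to0_cvg dt) u_u.
exists t, (fun k => w + (2^-1 * t k) *: u_ (t k)); split => //.
- by apply: cvg_add_scale0 ut; apply: cvg_half0; exact: dt.2.
- under eq_fun do rewrite tE.
  apply/fine_cvgP; split; first exact: nearW.
  exact: cvg_comp (down_to0_cvg dt) lim.
(* The deviation from [w] is [t k / 2] times [u_ (t k)], eventually bounded by [|u| + 1]; [m]
   converts the sup norm. *)
pose M : R := m%:R * (2^-1 * (`|u| + 1)).
apply: (@le_lt_trans _ _ M%:E); last exact: ltry.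
rewrite /limn_esup limf_esupE.
pose V := [set k | `|u_ (t k)| <= `|u| + 1].
apply: (@le_trans _ _ (ereal_sup
  ((fun k => (enorm (w + (2^-1 * t k) *: u_ (t k) - w) / t k)%:E) @` V))).
  apply: ereal_inf_lbound; exists V => //.
  move/cvgrPdist_le/(_ _ ltr01) : ut; apply: filterS => k uk.
  by rewrite /V/= -lerBlDl (le_trans (lerB_dist _ _))// distrC.
apply: ge_ereal_sup => _ [k Vk <-]; have tk0 := dt.1 k.
rewrite lee_fin ler_pdivrMr// [w + _]addrC addrK (le_trans (enorm_le _))//.
rewrite /M -[leRHS]mulrA ler_wpM2l// normrZ gtr0_norm ?mulr_gt0 ?invr_gt0//.
by rewrite mulrAC ler_wpM2r ?(ltW tk0)// ler_wpM2l ?invr_ge0.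
Qed.

(** A cycle of inclusions: outer limit, epigraph of [d2], inner limit, outer limit. *)
Lemma reducible_twice_epi_differentiable :
  twice_epi_differentiable (indicator_fun Omega) y lambda.
Proof.
have outer_epi : outer_limit (fun t : R =>
    epigraph (diff_quotient2 (indicator_fun Omega) y lambda t)) `<=` epigraph d2.
  move=> [w a] [t [z [dt zwa Cz]]].
  have z1 : (z k).1 @[k --> \oo] --> w by exact: cvg_comp zwa cvg_fst.
  have z2 : (z k).2 @[k --> \oo] --> a by exact: cvg_comp zwa cvg_snd.
  apply: (limf_einf_le_cvg (G := \oo) (g := fun k => (t k, (z k).1))
    (u := fun k => ((z k).2)%:E)).
  - by have := cvg_pair (down_to0_cvg dt) z1; apply.
  - by apply: nearW => k; exact: Cz.
  - by apply/fine_cvgP; split; [exact: nearW|exact: z2].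
have epi_inner : epigraph d2 `<=` inner_limit (fun t : R =>
    epigraph (diff_quotient2 (indicator_fun Omega) y lambda t)).
  move=> [w a]; rewrite /epigraph /= d2E; case: ifPn => [/asboolP cw|]; last first.
    by rewrite leye_eq.
  rewrite lee_fin => wa t dt.
  have [u_ lim [[u u_u] quotE]] := critical_recovery Oy red Nlambda cw.
  have ut : u_ (t k) @[k --> \oo] --> u by exact: cvg_comp (down_to0_cvg dt) u_u.
  (* The second coordinate keeps the height [a - value w >= 0] above the quotient. *)
  exists (fun k => (w + (2^-1 * t k) *: u_ (t k),
    a + (- dotp lambda (u_ (t k)) - value w))); split.
    have z1 : w + (2^-1 * t k) *: u_ (t k) @[k --> \oo] --> w.
      by apply: cvg_add_scale0 ut; apply: cvg_half0; exact: dt.2.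
    have z2 : a + (- dotp lambda (u_ (t k)) - value w) @[k --> \oo] --> a.
      have l1 : - dotp lambda (u_ (t k)) @[k --> \oo] --> value w.
        exact: cvg_comp (down_to0_cvg dt) lim.
      have l2 : - dotp lambda (u_ (t k)) - value w @[k --> \oo] --> (0 : R).
        by rewrite -(subrr (value w)); apply: cvgB => //; exact: cvg_cst.
      suff : a + (- dotp lambda (u_ (t k)) - value w) @[k --> \oo] --> a + 0.
        by rewrite addr0.
      by apply: cvgD => //; exact: cvg_cst.
    by have := cvg_pair z1 z2; apply.
  have : \forall k \near \oo, diff_quotient2 (indicator_fun Omega) y lambda (t k)
      (w + (2^-1 * t k) *: u_ (t k)) = (- dotp lambda (u_ (t k)))%:E.
    exact: down_to0_cvg dt _ quotE.
  apply: filterS => k /= ->; rewrite lee_fin; lra.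
split; apply/seteqP; split => //.
- exact: subset_trans epi_inner (@inner_outer_limit _ _ _).
- exact: subset_trans (@inner_outer_limit _ _ _) outer_epi.
Qed.

Lemma second_subderivative_proper : proper_fun d2.
Proof.
split=> [w|]; first by rewrite d2E; case: ifPn.
exists 0; rewrite d2E asboolT//.
apply/(critical_coneE lambda red); rewrite mul0mx dotp0r; split=> //.
by case: red => -[].
Qed.

End TwiceEpiDifferentiability.

(* For row vectors, nabla h (y) w = w *m 'J h y and
   nabla h (y)^* mu = mu *m ('J h y)^T. *)
Theorem theorem6p2 (R : realType) (m s : nat) (Omega : set 'rV[R]_m)
    (ybar : 'rV[R]_m) (Xi : set 'rV[R]_s) (h : 'rV[R]_m -> 'rV[R]_s)
    (lambda : 'rV[R]_m) (Omega_closed : closed Omega) (Omega_ybar : Omega ybar)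
    (Omega_red : C2_cone_reducible Omega ybar Xi h)
    (N_lambda : normal_cone Omega ybar lambda) :
  [/\ forall w, tangent_cone Omega ybar w ->
        parabolically_derivable Omega ybar w,
      parabolically_regular Omega ybar lambda,
      properly_twice_epi_differentiable (indicator_fun Omega) ybar lambda
    & exists mu : 'rV[R]_s,
        unique (fun mu' : 'rV[R]_s =>
                  lambda = mu' *m ('J h ybar)^T /\
                  normal_cone Xi (h ybar) mu') mu /\
        forall w : 'rV[R]_m,
          second_subderivative (indicator_fun Omega) ybar lambda w =
          if `[< critical_cone Omega ybar lambda w >]
          then (dotp mu (hess_map h ybar w w))%:E else +oo%E].
Proof.
split.
- move=> w /(tangent_cone_reducible Omega_red).
  exact: (reducible_parabolically_derivable Omega_red).
- exact: (reducible_parabolically_regular Omega_ybar Omega_red N_lambda).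
- split.
    exact: (reducible_twice_epi_differentiable Omega_ybar Omega_red N_lambda).
  exact: (second_subderivative_proper Omega_ybar Omega_red N_lambda).
- exists (multiplier ybar h lambda); split.
    exact: (multiplier_unique Omega_red N_lambda).
  exact: (second_subderivativeE Omega_ybar Omega_red N_lambda).
Qed.
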